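(* Let $(A,* )$ be a finite dimensional unital commutative associative algebra over $\mathbb{C}$ with identity $\hat{1}$, and let $B$ be a finite dimensional vertex $A$-algebroid such that $A$ is not a trivial module of the Leibniz algebra $B$. Suppose that $B$ is a semisimple Leibniz algebra with $\mathrm{Leib}(B)\neq\{0\}$ and $\mathrm{Ker}(\partial)=\{a\in A\mid u_0a=0\text{ for all }u\in B\}$. Assume that the Levi factor is $S=\mathrm{Span}\{e,f,h\}$ with $e_0f=h$, $h_0e=2e$, $h_0f=-2f$ and $e_1f=k\hat{1}\in\mathbb{C}\hat{1}\setminus\{0\}$. Write $A=\mathbb{C}\hat{1}\oplus\bigoplus_{j=1}^{l}N^j$ where each $N^j$ is an irreducible $sl_2$-submodule of $A$. Then: (i) $e_1e=f_1f=e_1h=f_1h=0$, $k=1$, $h_1h=2\hat{1}$; (ii) $\mathrm{Ker}(\partial)=\mathbb{C}\hat{1}$; (iii) for $j\in\{1,\dots,l\}$, $\dim N^j=2$, and $\dim\mathrm{Leib}(B)=2l$; (iv) $A$ is a local algebra. For each $j$, let $a_{j,0}$ be a highest weight vector of $N^j$ and $a_{j,1}=f_0(a_{j,0})$. Then $\{\hat{1},a_{j,i}\mid j\in\{1,\dots,l\},\ i\in\{0,1\}\}$ is a basis of $A$ and $\{\partial(a_{j,i})\mid j\in\{1,\dots,l\},\ i\in\{0,1\}\}$ is a basis of $\mathrm{Leib}(B)$. For all $j,j'\in\{1,\dots,l\}$ and $i,i'\in\{0,1\}$ the following relations hold (with $a_{j,-1}=a_{j,2}=0$): $$a_{j,i}*a_{j',i'}=0,$$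 $$a_{j,0}\cdot e=0,\quad a_{j,1}\cdot e=\partial(a_{j,0}),$$ $$a_{j,0}\cdot f=\partial(a_{j,1}),\quad a_{j,1}\cdot f=0,$$ $$a_{j,0}\cdot h=\partial(a_{j,0}),\quad a_{j,1}\cdot h=-\partial(a_{j,1}),$$ $$a_{j,i}\cdot\partial(a_{j',i'})=0,$$ $$\partial(a_{j,i})_1e=e_0a_{j,i}=(2-i)a_{j,i-1},$$ $$\partial(a_{j,i})_1f=f_0a_{j,i}=(i+1)a_{j,i+1},$$ $$\partial(a_{j,i})_1h=h_0a_{j,i}=(1-2i)a_{j,i}.$$
   Context: A (left) Leibniz algebra is a vector space $\mathfrak{L}$ over $\mathbb{C}$ with a bilinear bracket satisfying $[a,[b,c]]=[[a,b],c]+[b,[a,c]]$. An ideal is a subspace $I$ with $[\mathfrak{L},I]\subseteq I$ and $[I,\mathfrak{L}]\subseteq I$. $\mathrm{Leib}(\mathfrak{L})=\mathrm{Span}\{[u,u]\mid u\in\mathfrak{L}\}$, an ideal. $\mathrm{rad}(\mathfrak{L})$ is the maximal solvable ideal. $\mathfrak{L}$ is semisimple if $\mathrm{rad}(\mathfrak{L})=\mathrm{Leib}(\mathfrak{L})$. A Levi factor is a subalgebra $S$ that is a semisimple Lie algebra with $\mathfrak{L}=S\dot{+}\mathrm{rad}(\mathfrak{L})$ (direct sum of vector spaces). Here $S\cong sl_2$ with usual basis $e,f,h$. Let $(A,* )$ be a unital commutative associative $\mathbb{C}$-algebra with identity $\hat{1}$. A vertex $A$-algebroid is a $\mathbb{C}$-vector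 space $B$ with: a $\mathbb{C}$-bilinear map $A\times B\to B$, $(a,v)\mapsto a\cdot v$, with $\hat 1\cdot v=v$; a Leibniz algebra bracket $[\ ,\ ]$ on $B$; a Leibniz algebra homomorphism $\pi:B\to \mathrm{Der}(A)$; a symmetric $\mathbb{C}$-bilinear pairing $\langle\ ,\ \rangle:B\otimes_{\mathbb{C}}B\to A$; a $\mathbb{C}$-linear map $\partial:A\to B$ with $\pi\circ\partial=0$; such that for $a,a'\in A$, $u,v,v_1,v_2\in B$: $a\cdot(a'\cdot v)-(a*a')\cdot v=\pi(v)(a)\cdot\partial(a')+\pi(v)(a')\cdot\partial(a)$; $[u,a\cdot v]=\pi(u)(a)\cdot v+a\cdot[u,v]$; $[u,v]+[v,u]=\partial(\langle u,v\rangle)$; $\pi(a\cdot v)=a\pi(v)$; $\langle a\cdot u,v\rangle=a*\langle u,v\rangle-\pi(u)(\pi(v)(a))$; $\pi(v)(\langle v_1,v_2\rangle)=\langle[v,v_1],v_2\rangle+\langle v_1,[v,v_2]\rangle$; $\partial(a*a')=a\cdot\partial(a')+a'\cdot\partial(a)$; $[v,\partial(a)]=\partial(\pi(v)(a))$; $\langle v,\partial(a)\rangle=\pi(v)(a)$. Notation: $u_0v=[u,v]$, $u_1v=\langle u,v\rangle$, $u_0a=\pi(u)(a)$ for $u,v\in B$, $a\in A$. The Leibniz algebra $B$ means $(B,[\ ,\ ])$; $A$ is a $B$-module via $u\cdot a=u_0a$, and it is trivial if $u_0a=0$ for all $u\in B,a\in A$. $A$ is an $sl_2$-module via the operators $s_0$,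 $s\in S$. $\mathrm{Ker}(\partial)=\{a\in A\mid\partial(a)=0\}$. A local algebra is a commutative algebra with a unique maximal ideal. *)

(* Defs.v *)
(* boolp is used only for the span of a Prop-valued family.                   *)
From HB Require Import structures.
From mathcomp Require Import all_boot all_order all_algebra all_field.
From mathcomp Require Import boolp classical_sets.
From mathcomp Require Import reals.
From mathcomp Require Import complex.

Set Implicit Arguments.
Unset Strict Implicit.
Unset Printing Implicit Defensive.

Import Order.TTheory GRing.Theory Num.Theory.
Local Open Scope ring_scope.

Section Span.
Variables (F : fieldType) (V : vectType F).

Definition is_span (P : V -> Prop) (U : {vspace V}) : Prop :=
  forall v, v \in U <->
    exists2 s : seq V, (forall x, x \in s -> P x) & v \in <<s>>%VS.

Definition spanp (P : V -> Prop) : {vspace V} := xget 0%VS (is_span P).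

(* The default value 0 in spanp is never used for lack of a span.             *)
Lemma spanpP (P : V -> Prop) : is_span P (spanp P).
Proof.
rewrite /spanp; apply: (@xgetPex _ 0%VS (is_span P)).
pose Q (n : nat) : bool := `[< exists2 s : seq V,
  (forall x, x \in s -> P x) & \dim <<s>>%VS = n >].
have exQ : exists n, Q n by exists (\dim <<([::] : seq V)>>%VS); apply/asboolP; exists [::].
have ubQ n : Q n -> (n <= \dim {:V}%VS)%N.
  by move=> /asboolP[s _ <-]; rewrite dimvS ?subvf.
have [m /asboolP[s sP dims] maxm] := ex_maxnP exQ ubQ.
have inS x : P x -> x \in <<s>>%VS.
  move=> Px; have le_s : (<<s>> <= <<x :: s>>)%VS.
    by apply: sub_span => y ys; rewrite inE ys orbT.
  have : (\dim <<x :: s>>%VS <= m)%N.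
    apply: maxm; apply/asboolP; exists (x :: s) => // y.
    by rewrite inE => /orP[/eqP-> | /sP].
  rewrite -dims => le_xs.
  have /eqP -> : <<s>>%VS == <<x :: s>>%VS by rewrite eqEdim le_s le_xs.
  by rewrite memv_span ?mem_head.
exists <<s>>%VS => v; split=> [vs | [t tP]]; first by exists s.
by apply/subvP; apply/span_subvP => x /tP /inS.
Qed.

End Span.

(* Notions relative to a subspace L closed under the bracket, so that they    *)
(* apply both to a whole Leibniz algebra (L = fullv) and to a subalgebra of   *)
(* it.  A bilinear bracket is an element of 'Hom(V, 'End(V)).                 *)
Section LeibnizAlgebra.
Variables (F : fieldType) (V : vectType F) (br : 'Hom(V, 'End(V))).
Implicit Types L I R S : {vspace V}.

Definition leibniz_identity : Prop :=
  forall a b c, br a (br b c) = br (br a b) c + br b (br a c).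

Definition is_subalgebra S : Prop :=
  forall u v, u \in S -> v \in S -> br u v \in S.

Definition is_ideal L I : Prop :=
  (I <= L)%VS /\
  forall u v, u \in L -> v \in I -> br u v \in I /\ br v u \in I.

Definition Leib L : {vspace V} :=
  spanp (fun w => exists2 u, u \in L & w = br u u).

Definition brackets I : {vspace V} :=
  spanp (fun w => exists u v, [/\ u \in I, v \in I & w = br u v]).

Definition is_solvable I : Prop := exists n, iter n brackets I = 0%VS.

Definition is_rad L R : Prop :=
  [/\ is_ideal L R, is_solvable R
    & forall I, is_ideal L I -> is_solvable I -> (I <= R)%VS].

Definition is_semisimple L : Prop := is_rad L (Leib L).

Definition is_lie S : Prop := forall u, u \in S -> br u u = 0.

Definition is_levi_factor L S : Prop :=
  [/\ (S <= L)%VS, is_subalgebra S, is_lie S, is_semisimple S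
    & exists R, [/\ is_rad L R, (S + R)%VS = L & (S :&: R)%VS = 0%VS]].

End LeibnizAlgebra.

Section CommutativeAlgebra.
Variables (F : fieldType) (A : falgType F).

Definition is_derivation (d : 'End(A)) : Prop :=
  forall a b, d (a * b) = d a * b + a * d b.

(* One-sided, hence meaningful as stated for commutative A only; ideals of a  *)
(* unital algebra are automatically subspaces.                                *)
Definition alg_ideal (I : {vspace A}) : Prop :=
  forall a x, x \in I -> a * x \in I.

Definition maximal_alg_ideal (M : {vspace A}) : Prop :=
  [/\ alg_ideal M, M <> fullv
    & forall I, alg_ideal I -> (M <= I)%VS -> I = M \/ I = fullv].

Definition is_local : Prop := exists! M : {vspace A}, maximal_alg_ideal M.

End CommutativeAlgebra.

(* va_dot a v = a . v,  va_br u v = [u, v] = u_0 v,  va_pi u a = u_0 a,       *)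
(* va_pair u v = <u, v> = u_1 v.                                              *)
Record vertex_algebroid (F : fieldType) (A : falgType F) (B : vectType F) :=
  VertexAlgebroid {
  va_dot : 'Hom(A, 'End(B));
  va_br : 'Hom(B, 'End(B));
  va_pi : 'Hom(B, 'End(A));
  va_pair : 'Hom(B, 'Hom(B, A));
  va_d : 'Hom(A, B);
  va_dot1 : forall v, va_dot 1 v = v;
  va_leibniz : leibniz_identity va_br;
  va_pi_der : forall v, is_derivation (va_pi v);
  va_pi_br : forall u v a,
    va_pi (va_br u v) a = va_pi u (va_pi v a) - va_pi v (va_pi u a);
  va_pairC : forall u v, va_pair u v = va_pair v u;
  va_pi_d : forall a b, va_pi (va_d a) b = 0;
  va_dotA : forall a a' v,
    va_dot a (va_dot a' v) - va_dot (a * a') v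
    = va_dot (va_pi v a) (va_d a') + va_dot (va_pi v a') (va_d a);
  va_br_dot : forall u a v,
    va_br u (va_dot a v) = va_dot (va_pi u a) v + va_dot a (va_br u v);
  va_br_sym : forall u v, va_br u v + va_br v u = va_d (va_pair u v);
  va_pi_dot : forall a v b, va_pi (va_dot a v) b = a * va_pi v b;
  va_pair_dot : forall a u v,
    va_pair (va_dot a u) v = a * va_pair u v - va_pi u (va_pi v a);
  va_pi_pair : forall v v1 v2,
    va_pi v (va_pair v1 v2)
    = va_pair (va_br v v1) v2 + va_pair v1 (va_br v v2);
  va_d_mul : forall a a',
    va_d (a * a') = va_dot a (va_d a') + va_dot a' (va_d a);
  va_br_d : forall v a, va_br v (va_d a) = va_d (va_pi v a);
  va_pair_d : forall v a, va_pair v (va_d a) = va_pi v a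
}.

Section Modules.
Variables (F : fieldType) (A B : vectType F) (act : 'Hom(B, 'End(A))).
Implicit Types (S : {vspace B}) (N M : {vspace A}).

Definition trivial_module : Prop := forall u a, act u a = 0.

Definition is_submodule S N : Prop :=
  forall s a, s \in S -> a \in N -> act s a \in N.

Definition irreducible_submodule S N : Prop :=
  [/\ is_submodule S N, N <> 0%VS
    & forall M, is_submodule S M -> (M <= N)%VS -> M = 0%VS \/ M = N].

Definition highest_weight_vector (e h : B) N (a : A) : Prop :=
  [/\ a \in N, a <> 0, act e a = 0 & exists c : F, act h a = c *: a].

(* The family (a_i) with a_0 = a0 and a_1 = f_0 a0; it is extended by 0 to    *)
(* all other integers i, so that a_(-1) = a_2 = 0.                            *)
Definition weight_vectors (f : B) (a0 : A) (i : int) : A :=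
  if i == 0 then a0 else if i == 1 then act f a0 else 0.

End Modules.

(* Main.v *)
Require Import Defs.
From HB Require Import structures.
From mathcomp Require Import all_boot all_order all_algebra all_field.
From mathcomp Require Import boolp classical_sets.
From mathcomp Require Import reals.
From mathcomp Require Import complex.
From mathcomp Require Import ring.

Set Implicit Arguments.
Unset Strict Implicit.
Unset Printing Implicit Defensive.

Import Order.TTheory GRing.Theory Num.Theory.
Local Open Scope ring_scope.

(* Since d A is an abelian ideal, Leib(B) = d A and B = S + d A.  The pairing  *)
(* with e, f, h is nondegenerate on B, while on d b it is the action on b, so  *)
(* an element a . e of B is known once its pairings <a . e, s> are.  Writing   *)
(* a . e = s + d b, the sl2-relations on b show that a highest weight vector a *)
(* of weight n > 0 forces n = k, one of weight 0 is a scalar, and a lowest     *)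
(* weight vector a of weight - k forces k = 1.  So A is the sum of C.1 and of  *)
(* two-dimensional modules.  Products of their elements have weight 2 or - 2  *)
(* and vanish, or weight 0 and are scalars, which vanish because a0 a0 = 0.    *)
(* This makes A local, and nondegeneracy gives the remaining relations.        *)
(* Everything is symmetric under (e, f, h) -> (f, e, - h).                     *)

(** The pairing is what makes A rigid. By [Leib_limg] and [levi_split], B = S + d A, where S pairs
    with itself by multiples of 1 and <d b, s> is the action of s on b. Derivations kill 1, so the
    two contributions cannot cancel ([scalar_preimage]), and pairings with e, f, h determine an
    element of B ([pair_nondegenerate]).

    For a weight vector a, splitting a . e yields some b whose D b and H b are known up to scalars;
    [H, D] = - 2 D at b is then a polynomial condition on the weight of a ([highest_weight_scalar],
    [lowest_weight_scalar]). Only scalars and doublets survive, and k = 1 ([irreducible_doublet]).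
    Weights make all products of doublets vanish ([mul_doublet]), so A is local by
    [local_square_zero]. Since d has kernel C.1, rank-nullity gives the dimension of Leib(B). *)

Lemma span2P (F : fieldType) (V : vectType F) (u v w : V) :
  w \in <<[:: u; v]>>%VS -> exists x y, w = x *: u + y *: v.
Proof.
rewrite !span_cons span_nil addv0.
by case/memv_addP=> _ /vlineP[x ->] [_ /vlineP[y ->] ->]; exists x, y.
Qed.

(** * Eigenvectors of endomorphisms and of operators that shift them *)

Section Eigenvalues.
Import VectorInternalTheory.
Variables (F : numClosedFieldType).

Lemma v2r_lfun (V : vectType F) (T : 'End(V)) v : v2r (T v) = v2r v *m f2mx T.
Proof. by rewrite unlock /= r2vK. Qed.

Lemma lfun_eigenvalues (V : vectType F) (T : 'End(V)) :
  exists s : seq F, forall v z, v != 0 -> T v = z *: v -> z \in s.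
Proof.
have [s char_eq] := closed_field_poly_normal (char_poly (f2mx T)).
exists s => v z v_neq0 Tv.
rewrite -root_prod_XsubC -(_ : char_poly (f2mx T) = \prod_(x <- s) ('X - x%:P)).
  rewrite -eigenvalue_root_char; apply/eigenvalueP; exists (v2r v).
    by rewrite -v2r_lfun Tv linearZ.
  by apply: contra_neq v_neq0 => v0; apply: v2r_inj; rewrite v0 linear0.
by rewrite {1}char_eq (monicP (char_poly_monic _)) scale1r.
Qed.

Lemma lfun_eigenvector (V : vectType F) (T : 'End(V)) :
  (0 < dim V)%N -> exists v z, v != 0 /\ T v = z *: v.
Proof.
move=> /(eigenvalue_closed (f2mx T))[z /eigenvalueP[r Tr r_neq0]].
exists (r2v r), z; split.
  by apply: contra_neq r_neq0 => r0; rewrite -[r]r2vK r0 linear0.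
by apply: (@v2r_inj _ V); rewrite v2r_lfun linearZ /= !r2vK Tr.
Qed.

Lemma stable_eigenvector (V : vectType F) (T : 'End(V)) (U : {vspace V}) :
    U <> 0%VS -> (forall v, v \in U -> T v \in U) ->
  exists v z, [/\ v \in U, v != 0 & T v = z *: v].
Proof.
move=> /eqP U_neq0 TU.
pose W : vectType F := subvs_of U.
pose g : 'End(W) := linfun (vsproj U \o T \o vsval).
have dimW : (0 < dim W)%N by rewrite /dim /= lt0n dimv_eq0.
have [w [z [w_neq0 gw]]] := lfun_eigenvector g dimW.
exists (vsval w), z; split; first exact: subvsP.
  by apply: contra_neq w_neq0; exact: (@subvs_inj _ _ U w 0).
by move: gw => /(congr1 vsval); rewrite lfunE /= vsprojK ?TU ?subvsP.
Qed.

(** Otherwise the D^n v would be eigenvectors of T for the pairwise distinct values z + c n, while T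
    has finitely many eigenvalues. *)
Lemma shift_nilpotent (V : vectType F) (T D : 'End(V)) (c z : F) (v : V) :
    c != 0 -> (forall x, T (D x) = D (T x) + c *: D x) -> T v = z *: v ->
  exists n, iter n D v = 0.
Proof.
move=> c_neq0 TD Tv; have [s sP] := lfun_eigenvalues T.
have Tn n : T (iter n D v) = (z + c *+ n) *: iter n D v.
  elim: n => [|n IHn] /=; first by rewrite addr0.
  by rewrite TD IHn linearZ -scalerDl mulrSr addrA.
apply: contrapT => Dn_neq0.
pose t := [seq z + c *+ n | n <- iota 0 (size s).+1].
have : (size t <= size s)%N.
  apply: uniq_leq_size => [|_ /mapP[n _ ->]].
    rewrite map_inj_uniq ?iota_uniq // => m n /addrI.
    rewrite -![c *+ _]mulr_natr => /(mulfI c_neq0)/eqP.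
    by rewrite eqr_nat => /eqP.
  by apply: sP (Tn n); apply/eqP => Dn0; apply: Dn_neq0; exists n.
by rewrite size_map size_iota ltnn.
Qed.

Lemma iter_last_neq0 (V : vectType F) (D : 'End(V)) (v : V) :
    v != 0 -> (exists n, iter n D v = 0) ->
  exists n, iter n D v != 0 /\ D (iter n D v) = 0.
Proof.
move=> v_neq0 [n]; elim: n => [/eqP|n IHn] /=; first by rewrite (negPf v_neq0).
by move=> Dn0; have [/IHn|Dn_neq0] := eqVneq (iter n D v) 0; last exists n.
Qed.

End Eigenvalues.

(** * Extremal weight vectors of sl2-modules *)

Section Sl2Module.
Variables (F : numClosedFieldType) (V : vectType F) (E D H : 'End(V)).
Hypothesis EDH : forall v, E (D v) = D (E v) + H v.
Hypothesis HE : forall v, H (E v) = E (H v) + 2 *: E v.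
Hypothesis HD : forall v, H (D v) = D (H v) + (- 2) *: D v.

(** An H-eigenvector is raised by E until E kills it, then lowered by D until D kills it. Evaluating
    E D^(n+1) v = 0 forces the weight of v to be the number n of lowering steps. *)
Lemma sl2_extremal_vectors (U : {vspace V}) :
    U <> 0%VS ->
    (forall v, v \in U -> [/\ E v \in U, D v \in U & H v \in U]) ->
  exists (n : nat) v, [/\ v \in U, v != 0, E v = 0, H v = n%:R *: v &
    [/\ iter n D v \in U, iter n D v != 0, D (iter n D v) = 0
      & H (iter n D v) = (- n%:R) *: iter n D v]].
Proof.
move=> U_neq0 stabU.
have iterU (T : 'End(V)) : (forall v, v \in U -> T v \in U) ->
    forall n v, v \in U -> iter n T v \in U.
  by move=> TU; elim=> [|n IHn] v vU //=; apply/TU/IHn.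
have iterH (T : 'End(V)) (c z : F) v : (forall x, H (T x) = T (H x) + c *: T x) ->
    H v = z *: v -> forall n, H (iter n T v) = (z + c *+ n) *: iter n T v.
  move=> HT Hv; elim=> [|n IHn] /=; first by rewrite addr0.
  by rewrite HT IHn linearZ -scalerDl mulrSr addrA.
have two_neq0 : 2 != 0 :> F by rewrite pnatr_eq0.
have [u [z [uU u_neq0 Hu]]] : exists u z, [/\ u \in U, u != 0 & H u = z *: u].
  by apply: stable_eigenvector => // v /stabU[].
have [i [Ei_neq0 EEi]] :=
  iter_last_neq0 u_neq0 (shift_nilpotent two_neq0 HE Hu).
have := iterH _ _ _ _ HE Hu i; have : iter i E u \in U.
  by apply: iterU uU => v /stabU[].
move: (z + _) (iter i E u) Ei_neq0 EEi => {u uU u_neq0 Hu}m v v_neq0 Ev vU Hv.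
have m2_neq0 : - 2 != 0 :> F by rewrite oppr_eq0.
have [n [Dn_neq0 DDn]] := iter_last_neq0 v_neq0 (shift_nilpotent m2_neq0 HD Hv).
have Hn := iterH _ _ _ _ HD Hv.
(* The coefficient is the sum m + (m - 2) + ... + (m - 2 j) of the weights met on the way down. *)
have En j : E (iter j.+1 D v) = (j.+1%:R * (m - j%:R)) *: iter j D v.
  elim: j => [|j IHj]; first by rewrite /= EDH Ev linear0 Hv add0r mul1r subr0.
  rewrite iterS EDH IHj linearZ Hn -scalerDl; congr (_ *: _).
  by rewrite -mulr_natr -!natr1; ring.
have m_eq : m = n%:R.
  move: (En n); rewrite /= DDn linear0 => /esym/eqP.
  by rewrite scaler_eq0 (negPf Dn_neq0) orbF mulf_eq0 pnatr_eq0 subr_eq0 => /eqP.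
exists n, v; split=> //; first by rewrite Hv m_eq.
split=> //; first by apply: iterU vU => x /stabU[].
by rewrite Hn m_eq; congr (_ *: _); rewrite -mulr_natr; ring.
Qed.

End Sl2Module.

(** * Algebroids of the form sl2 + d A *)

Section SplitAlgebroid.
Variables (F : numFieldType) (A : falgType F) (B : vectType F).
Variable X : vertex_algebroid A B.
Local Notation pi := (va_pi X).
Local Notation dot := (va_dot X).
Local Notation "<< u , v >>" := (va_pair X u v).
Local Notation d := (va_d X).
Local Notation br := (va_br X).

Lemma va_pi1 u : pi u 1 = 0.
Proof.
have := va_pi_der X u 1 1.
rewrite !mulr1 mul1r => /(canLR (addrK _)); by rewrite subrr.
Qed.

Lemma va_piZ u c a : pi u (c *: a) = c *: pi u a.
Proof. exact: linearZ. Qed.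

Lemma va_piB u a b : pi u (a - b) = pi u a - pi u b.
Proof. exact: linearB. Qed.

Lemma va_pair_d_l a u : <<d a, u>> = pi u a.
Proof. by rewrite va_pairC va_pair_d. Qed.

(** Brackets are listed in both orders because [va_br] need not be antisymmetric. The list of
    conditions is stable under exchanging e and f. *)
Record sl2_split (e f h : B) (k : F) : Prop := Sl2Split {
  sl2_ef : br e f = h; sl2_fe : br f e = - h;
  sl2_he : br h e = 2 *: e; sl2_eh : br e h = (- 2) *: e;
  sl2_hf : br h f = (- 2) *: f; sl2_fh : br f h = 2 *: f;
  sl2_pair_ee : <<e, e>> = 0; sl2_pair_ff : <<f, f>> = 0;
  sl2_pair_eh : <<e, h>> = 0; sl2_pair_fh : <<f, h>> = 0;
  sl2_pair_hh : <<h, h>> = (2 * k) *: 1; sl2_pair_ef : <<e, f>> = k *: 1;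
  sl2_decomp : forall w, exists x y z b, w = x *: e + y *: f + z *: h + d b;
  sl2_inv : forall a, pi e a = 0 -> pi f a = 0 -> pi h a = 0 -> d a = 0
}.

(** This is the Chevalley involution; through it, each statement about e or highest weights also
    serves for f or lowest weights. *)
Lemma sl2_split_swap e f h k : sl2_split e f h k -> sl2_split f e (- h) k.
Proof.
case=> ef fe he eh hf fh ee ff peh pfh hh pef decomp inv.
have NL u : br (- h) u = - br h u by rewrite linearN opp_lfunE.
have pNL u : << - h, u>> = - <<h, u>> by rewrite linearN opp_lfunE.
split; rewrite ?NL ?pNL ?linearN //= ?ef ?fe ?hf ?he ?fh ?eh ?peh ?pfh ?hh ?opprK ?oppr0 //;
  rewrite -?scaleNr ?opprK //.
- by rewrite va_pairC.
- move=> w; have [x [y [z [b ->]]]] := decomp w; exists y, x, (- z), b.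
  by rewrite scalerN scaleNr opprK [y *: f + _]addrC.
- move=> a fa ea; rewrite opp_lfunE => /eqP; rewrite oppr_eq0 => /eqP.
  exact: inv.
Qed.

(** * Nondegeneracy of the pairing and the possible weights *)

Section Split.
Variables (e f h : B) (k : F).
Hypothesis Xs : sl2_split e f h k.
Hypothesis k_neq0 : k != 0.
Local Notation E := (pi e).
Local Notation D := (pi f).
Local Notation H := (pi h).

Lemma sl2_ED a : E (D a) = D (E a) + H a.
Proof. by rewrite -(sl2_ef Xs) va_pi_br addrC subrK. Qed.

Lemma sl2_HE a : H (E a) = E (H a) + 2 *: E a.
Proof.
have := va_pi_br X h e a; rewrite (sl2_he Xs) linearZ scale_lfunE /= => ->.
by rewrite addrC subrK.
Qed.

Lemma sl2_HD a : H (D a) = D (H a) + (- 2) *: D a.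
Proof.
have := va_pi_br X h f a; rewrite (sl2_hf Xs) linearZ scale_lfunE /= => ->.
by rewrite addrC subrK.
Qed.

Lemma pair_decomp x y z b (w := x *: e + y *: f + z *: h + d b) :
  [/\ <<w, e>> = (y * k) *: 1 + E b, <<w, f>> = (x * k) *: 1 + D b
    & <<w, h>> = (z * (2 * k)) *: 1 + H b].
Proof.
have sl2C := va_pairC X; rewrite /w !linearD !linearZ /= !add_lfunE !scale_lfunE !va_pair_d_l.
rewrite [<<f, e>>]sl2C [<<h, e>>]sl2C [<<h, f>>]sl2C.
rewrite (sl2_pair_ee Xs) (sl2_pair_ff Xs) (sl2_pair_eh Xs) (sl2_pair_fh Xs).
rewrite (sl2_pair_hh Xs) (sl2_pair_ef Xs) !scalerA.
by rewrite !scaler0 !add0r !addr0.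
Qed.

(** Each commutation relation, evaluated at b, has only derivatives of scalars left besides the
    value in question. *)
Lemma scalar_preimage x y z b :
    E b = x *: 1 -> D b = y *: 1 -> H b = z *: 1 ->
  [/\ x = 0, y = 0 & z = 0].
Proof.
move=> Eb Db Hb.
have eq0 c : c *: (1 : A) = 0 -> c = 0.
  by move/eqP; rewrite scaler_eq0 oner_eq0 orbF => /eqP.
have pi0 u c : pi u (c *: 1) = 0 by rewrite linearZ /= va_pi1 scaler0.
have two_neq0 : 2 != 0 :> F by rewrite pnatr_eq0.
split; apply: eq0.
- by have := sl2_HE b; rewrite Eb Hb !pi0 add0r => /esym/eqP;
    rewrite scaler_eq0 (negPf two_neq0) => /eqP.
- by have := sl2_HD b; rewrite Db Hb !pi0 add0r => /esym/eqP;
    rewrite scaler_eq0 oppr_eq0 (negPf two_neq0) => /eqP.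
by have := sl2_ED b; rewrite Db Eb Hb !pi0 add0r.
Qed.

(** If w = s + d b pairs to 0, then E b, D b and H b are scalars, hence 0; so s = 0 because k is
    nonzero, and d b = 0 by [sl2_inv]. *)
Lemma pair_nondegenerate w : <<w, e>> = 0 -> <<w, f>> = 0 -> <<w, h>> = 0 -> w = 0.
Proof.
have [x [y [z [b ->]]]] := sl2_decomp Xs w.
have [-> -> ->] := pair_decomp x y z b.
have addr0E c (v : A) : c *: 1 + v = 0 -> v = (- c) *: 1.
  by move/eqP; rewrite addrC addr_eq0 scaleNr => /eqP.
move=> /addr0E Eb /addr0E Db /addr0E Hb.
have [x0 y0 z0] := scalar_preimage Eb Db Hb.
move: x0 y0 z0 Eb Db Hb => /eqP; rewrite oppr_eq0 mulf_eq0 (negPf k_neq0) orbF => /eqP->.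
move=> /eqP; rewrite oppr_eq0 mulf_eq0 (negPf k_neq0) orbF => /eqP->.
move=> /eqP; rewrite oppr_eq0 !mulf_eq0 (negPf k_neq0) pnatr_eq0 !orbF => /eqP->.
rewrite !mul0r oppr0 !scale0r !add0r => Eb Db Hb.
exact: (sl2_inv Xs).
Qed.

Lemma pair_dot_e a :
  [/\ <<dot a e, e>> = - E (E a), <<dot a e, f>> = k *: a - E (D a)
    & <<dot a e, h>> = - E (H a)].
Proof.
rewrite !va_pair_dot (sl2_pair_ee Xs) (sl2_pair_ef Xs) (sl2_pair_eh Xs).
by rewrite !mulr0 !add0r -scalerAr mulr1.
Qed.

(* Write a . e = x e + y f + z h + d b.  Pairing with f and h computes D b and
   H b, and the claim is the relation [H, D] = - 2 D evaluated at b. *)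
Lemma highest_weight_scalar a m :
    E a = 0 -> H a = m *: a ->
  exists c, ((m + 2) * (k - m)) *: a = c *: 1.
Proof.
move=> Ea Ha; have [x [y [z [b ae]]]] := sl2_decomp Xs (dot a e).
have [_ af ah] := pair_dot_e a; have [_ bf bh] := pair_decomp x y z b.
have Db : D b = (k - m) *: a - (x * k) *: 1.
  move: af; rewrite ae bf sl2_ED Ea linear0 add0r Ha -scalerBl => <-.
  by rewrite addrAC subrr add0r.
have Hb : H b = - (z * (2 * k)) *: 1.
  move: ah; rewrite ae bh Ha linearZ /= Ea scaler0 oppr0 => /eqP.
  by rewrite addrC addr_eq0 scaleNr => /eqP.
(* This is - 2 times the scalar part - x k of D b. *)
exists (2 * (x * k)).
have key : ((k - m) * m) *: a = (- 2) *: ((k - m) *: a - (x * k) *: 1).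
  have := sl2_HD b; rewrite Hb Db !va_piB !va_piZ !va_pi1 Ha.
  by rewrite !scaler0 subr0 add0r scalerA.
rewrite [(m + 2) * _]mulrDl scalerDl [m * _]mulrC key scalerBr !scalerA.
by rewrite addrAC -scalerDl !mulNr addNr scale0r add0r scaleNr opprK.
Qed.

(** Again [H, D] = - 2 D is evaluated at the b of a . e = s + d b. Now H b contains m E a, and D (E
    a) = m a supplies the term quadratic in m. *)
Lemma lowest_weight_scalar a m :
    D a = 0 -> H a = (- m) *: a ->
  exists c, (2 * k - m * (k + m)) *: a = c *: 1.
Proof.
move=> Da Ha; have [x [y [z [b ae]]]] := sl2_decomp Xs (dot a e).
have [_ af ah] := pair_dot_e a; have [_ bf bh] := pair_decomp x y z b.
have Db : D b = k *: a - (x * k) *: 1.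
  by move: af; rewrite ae bf Da linear0 subr0 => <-; rewrite addrAC subrr add0r.
have Hb : H b = m *: E a - (z * (2 * k)) *: 1.
  move: ah; rewrite ae bh Ha linearZ /= scaleNr opprK => <-.
  by rewrite addrAC subrr add0r.
have DEa : D (E a) = m *: a.
  have := sl2_ED a; rewrite Da linear0 Ha => /esym/eqP.
  by rewrite scaleNr subr_eq0 => /eqP.
exists (2 * (x * k)).
have key : (- m * k) *: a = (m * m) *: a + (- 2) *: (k *: a - (x * k) *: 1).
  have := sl2_HD b; rewrite Hb Db !va_piB !va_piZ !va_pi1 Ha DEa.
  by rewrite !scaler0 !subr0 !scalerA mulrC.
have -> : 2 * k - m * (k + m) = - m * k + (2 * k - m * m) by ring.
rewrite scalerDl key scalerBr !scalerA addrAC addrA -!scalerDl.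
rewrite [X in X *: a](_ : _ = 0); last by ring.
by rewrite scale0r add0r mulNr scaleNr opprK.
Qed.

(** H kills scalars but multiplies a by the nonzero m. *)
Lemma weight_scalar_eq0 a m c x :
  a != 0 -> m != 0 -> H a = m *: a -> x *: a = c *: 1 -> x = 0.
Proof.
move=> a_neq0 m_neq0 Ha /(congr1 H).
rewrite !linearZ /= va_pi1 Ha scaler0 scalerA => /eqP.
by rewrite scaler_eq0 (negPf a_neq0) mulf_eq0 (negPf m_neq0) !orbF => /eqP.
Qed.

Lemma highest_weight_level a (n : nat) :
  a != 0 -> n != 0%N -> E a = 0 -> H a = n%:R *: a -> n%:R = k.
Proof.
move=> a_neq0 n_neq0 Ea Ha; have [c] := highest_weight_scalar Ea Ha.
have nR_neq0 : n%:R != 0 :> F by rewrite pnatr_eq0.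
move=> /(weight_scalar_eq0 a_neq0 nR_neq0 Ha)/eqP.
by rewrite mulf_eq0 -natrD pnatr_eq0 addn2 /= subr_eq0 => /eqP->.
Qed.

Lemma invariant_scalar a : E a = 0 -> H a = 0 -> exists c, a = c *: 1.
Proof.
move=> Ea Ha; have [|c] := @highest_weight_scalar a 0 Ea; first by rewrite scale0r.
rewrite add0r subr0 => ac; exists ((2 * k)^-1 * c).
by rewrite -scalerA -ac scalerA mulVf ?scale1r // mulf_neq0 ?pnatr_eq0.
Qed.

(** At m = k the factor in [lowest_weight_scalar] is 2 k (1 - k). *)
Lemma level1 a : a != 0 -> D a = 0 -> H a = (- k) *: a -> k = 1.
Proof.
move=> a_neq0 Da Ha; have [c] := lowest_weight_scalar Da Ha.
have Nk_neq0 : - k != 0 by rewrite oppr_eq0.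
move=> /(weight_scalar_eq0 a_neq0 Nk_neq0 Ha)/eqP.
have -> : 2 * k - k * (k + k) = 2 * k * (1 - k) by ring.
by rewrite !mulf_eq0 pnatr_eq0 (negPf k_neq0) /= subr_eq0 => /eqP.
Qed.

End Split.

(** * Two-dimensional modules: action on B and products *)

Record doublet (e f h : B) (a0 a1 : A) : Prop := Doublet {
  doublet_e0 : pi e a0 = 0; doublet_e1 : pi e a1 = a0;
  doublet_f0 : pi f a0 = a1; doublet_f1 : pi f a1 = 0;
  doublet_h0 : pi h a0 = a0; doublet_h1 : pi h a1 = - a1
}.

Lemma doublet_swap e f h a0 a1 :
  doublet e f h a0 a1 -> doublet f e (- h) a1 a0.
Proof.
case=> e0 e1 f0 f1 h0 h1.
by split=> //; rewrite linearN opp_lfunE ?h0 ?h1 ?opprK.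
Qed.

Lemma va_pi_mul u a b : pi u (a * b) = pi u a * b + a * pi u b.
Proof. exact: va_pi_der. Qed.


(** For a0 . e and a1 . e, both sides have the same pairings with e, f and h, so nondegeneracy
    applies. *)
Lemma dot_doublet_e e f h a0 a1 :
    sl2_split e f h 1 -> doublet e f h a0 a1 ->
  [/\ dot a0 e = 0, dot a1 e = d a0 & dot a0 h = d a0].
Proof.
move=> Xs [e0 e1 f0 f1 h0 h1].
have nondeg := pair_nondegenerate Xs (oner_neq0 F).
have [a0e a0f a0h] := pair_dot_e Xs a0.
have [a1e a1f a1h] := pair_dot_e Xs a1.
have dot_a0e : dot a0 e = 0.
  apply: nondeg; rewrite ?a0e ?a0f ?a0h ?h0 ?f0 ?e0 ?e1.
  - by rewrite linear0 oppr0.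
  - by rewrite scale1r subrr.
  - by rewrite oppr0.
have dot_a1e : dot a1 e = d a0.
  apply/eqP; rewrite -subr_eq0; apply/eqP.
  have pairBL u v w : <<u - v, w>> = <<u, w>> - <<v, w>>.
    by rewrite linearB add_lfunE opp_lfunE.
  apply: nondeg; rewrite pairBL va_pair_d_l ?a1e ?a1f ?a1h ?h0 ?h1 ?f0 ?f1 ?e0 ?e1.
  - by rewrite e0 oppr0 addr0.
  - by rewrite linear0 subr0 scale1r subrr.
  - by rewrite linearN /= e1 opprK subrr.
split=> //.
(* Bracketing a0 . e = 0 with f gives a1 . e - a0 . h = 0. *)
have := va_br_dot X f a0 e; rewrite dot_a0e linear0 f0 dot_a1e (sl2_fe Xs).
by rewrite linearN => /esym/eqP; rewrite subr_eq0 => /eqP.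
Qed.

Lemma dot_doublet_f e f h a0 a1 :
    sl2_split e f h 1 -> doublet e f h a0 a1 ->
  [/\ dot a1 f = 0, dot a0 f = d a1 & dot a1 h = - d a1].
Proof.
move=> /sl2_split_swap Xs /doublet_swap dblt.
have [-> -> a1h] := dot_doublet_e Xs dblt; split=> //.
by rewrite -a1h linearN opprK.
Qed.

(** A nonzero product would be a highest weight vector of weight 2, but the only positive weight
    allowed is k = 1. *)
Lemma mul_highest e f h a0 a1 b0 b1 :
    sl2_split e f h 1 -> doublet e f h a0 a1 -> doublet e f h b0 b1 ->
  a0 * b0 = 0.
Proof.
move=> Xs [e0 _ _ _ h0 _] [e0' _ _ _ h0' _].
have Ep : pi e (a0 * b0) = 0 by rewrite va_pi_mul e0 e0' mul0r mulr0 addr0.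
have Hp : pi h (a0 * b0) = 2 *: (a0 * b0).
  by rewrite va_pi_mul h0 h0' scaler_nat mulr2n.
apply: contraTeq isT => p_neq0.
by have /eqP := highest_weight_level Xs (n := 2) p_neq0 isT Ep Hp; rewrite pnatr_eq1.
Qed.

(** The product has weight 0 and is killed by E, because a0 b0 = 0; so it is a scalar c. Then c a0 =
    a0 a0 b1 = 0, so c = 0 or a0 = 0. *)
Lemma mul_highest_lowest e f h a0 a1 b0 b1 :
    sl2_split e f h 1 -> doublet e f h a0 a1 -> doublet e f h b0 b1 ->
  a0 * b1 = 0.
Proof.
move=> Xs da db; have [e0 _ _ _ h0 _] := da; have [_ e1 _ _ _ h1] := db.
have Ep : pi e (a0 * b1) = 0.
  by rewrite va_pi_mul e0 e1 mul0r add0r (mul_highest Xs da db).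
have Hp : pi h (a0 * b1) = 0 by rewrite va_pi_mul h0 h1 mulrN subrr.
have [c p_eq] := invariant_scalar Xs (oner_neq0 F) Ep Hp.
have /eqP : c *: a0 = 0.
  rewrite -[a0 in LHS]mulr1 scalerAr -p_eq mulrA (mul_highest Xs da da).
  by rewrite mul0r.
by rewrite p_eq scaler_eq0 => /orP[] /eqP c0; rewrite ?c0 ?scale0r // -p_eq c0 mul0r.
Qed.

Lemma mul_doublet e f h a0 a1 b0 b1 a b :
    sl2_split e f h 1 -> doublet e f h a0 a1 -> doublet e f h b0 b1 ->
    a \in [:: a0; a1] -> b \in [:: b0; b1] ->
  a * b = 0.
Proof.
move=> Xs da db; have Xs' := sl2_split_swap Xs.
have da' := doublet_swap da; have db' := doublet_swap db.
rewrite !inE => /orP[] /eqP-> /orP[] /eqP->.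
- exact: mul_highest Xs da db.
- exact: mul_highest_lowest Xs da db.
- exact: mul_highest_lowest Xs' da' db'.
- exact: mul_highest Xs' da' db'.
Qed.

(** Since [va_pi] vanishes on d A, the pairing of a . d b with v is the product of a and v_0 b. For
    v among e, f, h, the factor v_0 b is 0 or, up to sign, b0 or b1. *)
Lemma dot_d_doublet e f h b0 b1 a b :
    sl2_split e f h 1 -> doublet e f h b0 b1 -> a * b0 = 0 -> a * b1 = 0 ->
    b \in [:: b0; b1] ->
  dot a (d b) = 0.
Proof.
move=> Xs [e0 e1 f0 f1 h0 h1] ab0 ab1 b_in.
have pair_v v : <<dot a (d b), v>> = a * pi v b.
  by rewrite va_pair_dot va_pair_d_l va_pi_d subr0.
apply: (pair_nondegenerate Xs (oner_neq0 F)); rewrite pair_v;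
  move: b_in; rewrite !inE => /orP[] /eqP->;
  by rewrite ?e0 ?e1 ?f0 ?f1 ?h0 ?h1 ?mulrN ?ab0 ?ab1 ?mulr0 ?oppr0.
Qed.


(** * From semisimplicity and the Levi factor to [sl2_split] *)

Section LeviFactor.
Hypothesis B_semisimple : is_semisimple br fullv.
Hypothesis ker_d : forall a, a \in lker d <-> forall u, pi u a = 0.

(** On one side [u, u] = d <u, u> / 2. On the other, [d a, u] = 0, so d A is an abelian ideal and
    lies in the radical, which is Leib(B). *)
Lemma Leib_limg : Leib br fullv = limg d.
Proof.
have [_ _ Leib_max] := B_semisimple.
apply/eqP; rewrite eqEsubv; apply/andP; split.
  apply/subvP => w /(spanpP (fun w => exists2 u, u \in fullv & w = br u u) w)[s sP].
  apply: subvP w; apply/span_subvP => _ /sP[u _ ->].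
  have -> : br u u = d (2^-1 *: <<u, u>>).
    by rewrite linearZ /= -va_br_sym -mulr2n -scaler_nat scalerA mulVf ?scale1r ?pnatr_eq0.
  by rewrite memv_img ?memvf.
have d_br a u : br (d a) u = 0.
  have := va_br_sym X u (d a).
  by rewrite va_br_d va_pair_d addrC => /(canRL (addrK _)); rewrite subrr.
apply: Leib_max.
  split=> [|u _ _ /memv_imgP[a _ ->]]; first exact: subvf.
  by rewrite va_br_d d_br mem0v memv_img ?memvf.
exists 1%N; apply/eqP; rewrite -subv0; apply/subvP => w.
move=> /(spanpP _ w)[s sP]; apply: subvP w; apply/span_subvP => _ /sP[u [v [uI _ ->]]].
by move: uI => /memv_imgP[a _ ->]; rewrite d_br mem0v.
Qed.

(** The scalar <e, f> is killed by every derivation; invariance of the pairing propagates this to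
    the other pairings of e, f, h. The radical lies in Leib(B) = d A, whence the decomposition of
    B. *)
Lemma levi_split (S : {vspace B}) e f h k :
    is_levi_factor br fullv S -> basis_of S [:: e; f; h] ->
    br e f = h -> br h e = 2 *: e -> br h f = - 2 *: f -> <<e, f>> = k *: 1 ->
  sl2_split e f h k.
Proof.
move=> [_ _ S_lie _ [R [[R_ideal R_solv _] SR _]]] /span_basis S_span ef he hf pef.
have [_ _ Leib_max] := B_semisimple.
have S_mem u : u \in [:: e; f; h] -> u \in S by rewrite -S_span => /memv_span.
have [eS fS hS] : [/\ e \in S, f \in S & h \in S] by rewrite !S_mem ?inE ?eqxx ?orbT.
have brN u v : u \in S -> v \in S -> br v u = - br u v.
  move=> uS vS; have /S_lie : u + v \in S by rewrite memvD.
  rewrite !linearD /= !add_lfunE !(S_lie _ uS) !(S_lie _ vS) add0r addr0 => /eqP.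
  by rewrite addr_eq0 => /eqP.
have fe := brN _ _ eS fS; have eh := brN _ _ hS eS; have fh := brN _ _ hS fS.
have ee := S_lie _ eS; have ff := S_lie _ fS; have hh := S_lie _ hS.
rewrite ef in fe; rewrite he -scaleNr in eh; rewrite hf -scaleNr opprK in fh.
have pi_k u : pi u <<e, f>> = 0 by rewrite pef va_piZ va_pi1 scaler0.
have pairC := va_pairC X.
have two_neq0 : 2 != 0 :> F by rewrite pnatr_eq0.
have peh : <<e, h>> = 0.
  by have := va_pi_pair X e e f; rewrite pi_k ee ef linear0 zero_lfunE add0r.
have pfh : <<f, h>> = 0.
  have := va_pi_pair X f e f; rewrite pi_k ff fe !linear0 addr0 linearN opp_lfunE.
  by rewrite pairC => /esym/eqP; rewrite oppr_eq0 => /eqP.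
have pee : <<e, e>> = 0.
  have := va_pi_pair X e e h; rewrite peh linear0 ee eh linear0 zero_lfunE add0r.
  by rewrite linearZ => /esym/eqP; rewrite scaler_eq0 oppr_eq0 (negPf two_neq0) => /eqP.
have pff : <<f, f>> = 0.
  have := va_pi_pair X f f h; rewrite pfh linear0 ff fh linear0 zero_lfunE add0r.
  by rewrite linearZ => /esym/eqP; rewrite scaler_eq0 (negPf two_neq0) => /eqP.
have phh : <<h, h>> = (2 * k) *: 1.
  have := va_pi_pair X f e h; rewrite peh linear0 fe fh linearN opp_lfunE linearZ /= pef.
  by rewrite scalerA => /esym/eqP; rewrite addrC subr_eq0 => /eqP.
have decomp w : exists x y z b, w = x *: e + y *: f + z *: h + d b.
  have : w \in (S + R)%VS by rewrite SR memvf.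
  case/memv_addP=> s sS [r rR ->{w}].
  have : r \in limg d by rewrite -Leib_limg (subvP (Leib_max _ R_ideal R_solv)).
  case/memv_imgP=> b _ ->{r rR}.
  move: sS; rewrite -S_span !span_cons span_nil addv0.
  case/memv_addP=> _ /vlineP[x ->] [_ /memv_addP[_ /vlineP[y ->] [_ /vlineP[z ->] ->]] ->].
  by exists x, y, z, b; rewrite !addrA.
split=> // a Ea Da Ha.
(* As d A acts by 0 on A, being killed by e, f and h means being killed by all of B. *)
suff : a \in lker d by rewrite memv_ker => /eqP.
apply/ker_d => u; have [x [y [z [b ->]]]] := decomp u.
rewrite !linearD !linearZ /= !add_lfunE !scale_lfunE Ea Da Ha va_pi_d.
by rewrite !scaler0 !addr0.
Qed.

End LeviFactor.
End SplitAlgebroid.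

(** * Irreducible summands of A are doublets *)

Section IrreducibleSummand.
Variables (F : numClosedFieldType) (A : falgType F) (B : vectType F).
Variable X : vertex_algebroid A B.
Variables (e f h : B) (k : F) (S : {vspace B}).
Hypothesis Xs : sl2_split X e f h k.
Hypothesis k_neq0 : k != 0.
Hypothesis S_span : <<[:: e; f; h]>>%VS = S.
Local Notation pi := (va_pi X).

Lemma sl2_submoduleP (M : {vspace A}) :
  is_submodule pi S M <->
  forall a, a \in M -> [/\ pi e a \in M, pi f a \in M & pi h a \in M].
Proof.
split=> [subM a aM|subM s a].
  have S_mem u : u \in [:: e; f; h] -> u \in S by rewrite -S_span => /memv_span.
  by split; apply: subM; rewrite ?S_mem // !inE eqxx ?orbT.
rewrite -S_span !span_cons span_nil addv0.
case/memv_addP=> _ /vlineP[x ->] [_ /memv_addP[_ /vlineP[y ->] [_ /vlineP[z ->] ->]] ->].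
move=> /subM[ea fa ha].
by rewrite !linearD !linearZ /= !add_lfunE !scale_lfunE !(memvD, memvZ).
Qed.

Lemma doublet_free v :
  v != 0 -> doublet X e f h v (pi f v) -> free [:: v; pi f v].
Proof.
move=> v_neq0 [e0 e1 _ _ _ _]; rewrite free_cons span_seq1 seq1_free.
apply/andP; split; last first.
  by apply: contra_neq v_neq0 => fv0; rewrite -e1 fv0 linear0.
apply: contra v_neq0 => /vlineP[c v_eq].
have := congr1 (pi e) v_eq; rewrite e0 linearZ /= e1 => /esym/eqP.
by rewrite scaler_eq0 => /orP[] // /eqP c0; rewrite v_eq c0 scale0r.
Qed.

(** A highest weight vector v of weight 0 would be a scalar, so its weight n is positive and equals
    k; the lowest weight vector then gives k = 1. The span of v and f_0 v is a submodule, hence all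
    of N. *)
Lemma irreducible_doublet (N : {vspace A}) :
    irreducible_submodule pi S N -> (N :&: <[1]> = 0)%VS ->
  k = 1 /\ exists v, [/\ v != 0, doublet X e f h v (pi f v)
                       & basis_of N [:: v; pi f v]].
Proof.
move=> [/sl2_submoduleP subN N_neq0 minN] N1.
have [|n [v [vN v_neq0 Ev Hv [wN w_neq0 Dw Hw]]]] := sl2_extremal_vectors
  (sl2_ED Xs) (sl2_HE Xs) (sl2_HD Xs) N_neq0; first exact: subN.
have n_neq0 : n != 0%N.
  apply: contra_neq v_neq0 => n0; rewrite n0 scale0r in Hv.
  have [c v_eq] := invariant_scalar Xs k_neq0 Ev Hv.
  apply/eqP; rewrite -memv0 -N1 memv_cap vN v_eq.
  by apply/vlineP; exists c.
have kn := highest_weight_level Xs v_neq0 n_neq0 Ev Hv.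
rewrite kn in Hw; have k1 := level1 Xs k_neq0 w_neq0 Dw Hw.
have n1 : n = 1%N by apply/eqP; rewrite -(pnatr_eq1 F) kn k1.
move: Hv Hw Dw; rewrite n1 k1 /= scale1r scaleN1r => Hv Hw Dw.
have dv : doublet X e f h v (pi f v).
  by split=> //; rewrite (sl2_ED Xs) Ev linear0 add0r.
split=> //; exists v; split=> //.
rewrite /basis_of doublet_free // andbT; apply/eqP.
have [ee ef _ ff he hf] := dv.
have sub_spanN : (<<[:: v; pi f v]>> <= N)%VS.
  apply/span_subvP => u; rewrite !inE => /orP[] /eqP-> //.
  by have [] := subN _ vN.
case: (minN <<[:: v; pi f v]>>%VS) => //.
  apply/sl2_submoduleP => _ /span2P[x [y ->]].
  have vM : v \in <<[:: v; pi f v]>>%VS by rewrite memv_span ?mem_head.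
  have fvM : pi f v \in <<[:: v; pi f v]>>%VS by rewrite memv_span ?inE ?eqxx ?orbT.
  by split; rewrite linearD memvD // linearZ memvZ //= ?ee ?ef ?ff ?he ?hf ?memvN ?mem0v.
move=> span0; have : v \in <<[:: v; pi f v]>>%VS.
  by rewrite memv_span // !inE eqxx.
by rewrite span0 memv0 (negPf v_neq0).
Qed.

(** E sends x v + y f_0 v to y v, so every highest weight vector of N is a multiple of v. *)
Lemma highest_weight_doublet (N : {vspace A}) v a :
    doublet X e f h v (pi f v) -> basis_of N [:: v; pi f v] ->
    highest_weight_vector pi e h N a ->
  doublet X e f h a (pi f a) /\ basis_of N [:: a; pi f a].
Proof.
move=> [e0 e1 _ f1 h0 h1] Nv; have Nspan := span_basis Nv.
case; rewrite -{1}Nspan => /span2P[x [y ->]] a_neq0.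
rewrite linearD !linearZ /= e0 e1 scaler0 add0r => yv0 _.
move/eqP: yv0; rewrite scaler_eq0 => /orP[/eqP y0 | /eqP v0]; last first.
  by case: a_neq0; rewrite v0 (linear0 (pi f)) !scaler0 addr0.
move: a_neq0; rewrite {}y0 scale0r addr0 => /eqP xv_neq0.
have da : doublet X e f h (x *: v) (pi f (x *: v)).
  by split; rewrite ?linearZ /= ?linearZ /= ?e0 ?e1 ?f1 ?h0 ?h1 ?scaler0 ?scalerN.
split=> //; rewrite basisEfree doublet_free //=.
rewrite -(size_basis Nv) leqnn andbT.
have mem u : u \in [:: v; pi f v] -> u \in N by rewrite -Nspan => /memv_span.
apply/span_subvP => u; rewrite !inE => /orP[] /eqP->; rewrite ?linearZ /= memvZ //.
  by rewrite mem ?inE ?eqxx.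
by rewrite mem ?inE ?eqxx ?orbT.
Qed.

End IrreducibleSummand.

(** * Locality of a square-zero extension of the scalars *)

Lemma local_square_zero (F : fieldType) (A : falgType F) (M : {vspace A}) :
    (<[1]> + M)%VS = fullv -> (forall x y, x \in M -> y \in M -> x * y = 0) ->
  is_local A.
Proof.
move=> M_full MM.
have M_decomp a : exists c x, x \in M /\ a = c *: 1 + x.
  have : a \in (<[1]> + M)%VS by rewrite M_full memvf.
  by case/memv_addP=> _ /vlineP[c ->] [x xM ->]; exists c, x.
have M_ideal : alg_ideal M.
  move=> a x xM; have [c [y [yM ->]]] := M_decomp a.
  by rewrite mulrDl (MM y) // addr0 -scalerAl mul1r memvZ.
have ideal_full I : alg_ideal I -> 1 \in I -> I = fullv.
  move=> I_ideal I1; apply/eqP; rewrite eqEsubv subvf; apply/subvP => a _.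
  by rewrite -[a]mulr1 I_ideal.
have M_neq : M <> fullv.
  move=> M_eq; have := MM 1 1; rewrite M_eq !memvf mul1r => /(_ isT isT)/eqP.
  by rewrite oner_eq0.
(* (c - x)(c + x) = c^2 is a unit. *)
have ideal_sub I : alg_ideal I -> I <> fullv -> (I <= M)%VS.
  move=> I_ideal I_neq; apply/subvP => a aI.
  have [c [x [xM a_eq]]] := M_decomp a.
  have [c0|c_neq0] := eqVneq c 0; first by rewrite a_eq c0 scale0r add0r.
  case: I_neq; apply: ideal_full => //.
  have := I_ideal (c *: 1 - x) a aI; rewrite a_eq mulrDl mulrDr.
  rewrite mulNr mulrDr (MM x x) // addr0 -!scalerAl !mul1r -scalerAr mulr1.
  rewrite scalerA addrK => /(memvZ (c * c)^-1).
  by rewrite scalerA mulVf ?scale1r // mulf_neq0.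
exists M; split=> [|I [I_ideal I_neq I_max]].
  split=> // I I_ideal MI; have [-> | /eqP I_neq] := eqVneq I fullv; first by right.
  by left; apply/eqP; rewrite eqEsubv MI ideal_sub.
by have [|//|] := I_max M M_ideal; first exact: ideal_sub.
Qed.

(** * Assembly of the structure of A and Leib(B) *)

Theorem theorem38 (R : realType) (A : falgType R[i]) (B : vectType R[i])
  (mulAC : forall a b : A, a * b = b * a)
  (X : vertex_algebroid A B)
  (A_nontrivial : ~ trivial_module (va_pi X))
  (B_semisimple : is_semisimple (va_br X) fullv)
  (Leib_neq0 : Leib (va_br X) fullv <> 0%VS)
  (ker_d : forall a : A, a \in lker (va_d X) <-> forall u : B, va_pi X u a = 0)
  (S : {vspace B}) (S_levi : is_levi_factor (va_br X) fullv S)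
  (e f h : B) (S_basis : basis_of S [:: e; f; h])
  (ef : va_br X e f = h)
  (he : va_br X h e = 2 *: e)
  (hf : va_br X h f = - 2 *: f)
  (k : R[i]) (k_neq0 : k <> 0) (e1f : va_pair X e f = k *: 1)
  (l : nat) (N : 'I_l -> {vspace A})
  (N_irr : forall j, irreducible_submodule (va_pi X) S (N j))
  (A_sum : (<[1]> + \sum_j N j)%VS = fullv)
  (A_direct : directv (<[1]> + \sum_j N j)%VS) :
  (* (i) *)
  [/\ [/\ va_pair X e e = 0, va_pair X f f = 0, va_pair X e h = 0
        & va_pair X f h = 0],
      k = 1
    & va_pair X h h = 2 *: 1]
  /\
  (* (ii) *)
  lker (va_d X) = <[1]>%VS
  /\
  (* (iii) *)
  ((forall j, \dim (N j) = 2%N) /\ \dim (Leib (va_br X) fullv) = (2 * l)%N)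
  /\
  (* (iv) *)
  is_local A /\
  forall a0 : 'I_l -> A,
    (forall j, highest_weight_vector (va_pi X) e h (N j) (a0 j)) ->
    let a (j : 'I_l) (i : int) := weight_vectors (va_pi X) f (a0 j) i in
    [/\ basis_of fullv
          (1 :: [seq a j i | j <- enum 'I_l, i <- [:: 0; 1 : int]]),
        basis_of (Leib (va_br X) fullv)
          [seq va_d X (a j i) | j <- enum 'I_l, i <- [:: 0; 1 : int]]
      & forall (j j' : 'I_l) (i i' : int),
          i \in [:: 0; 1 : int] -> i' \in [:: 0; 1 : int] ->
          [/\ a j i * a j' i' = 0,
              [/\ va_dot X (a j 0) e = 0,
                  va_dot X (a j 1) e = va_d X (a j 0),
                  va_dot X (a j 0) f = va_d X (a j 1),
                  va_dot X (a j 1) f = 0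
                & va_dot X (a j 0) h = va_d X (a j 0) /\
                  va_dot X (a j 1) h = - va_d X (a j 1)],
              va_dot X (a j i) (va_d X (a j' i')) = 0,
              (va_pair X (va_d X (a j i)) e = va_pi X e (a j i) /\
               va_pi X e (a j i) = (2 - i)%:~R *: a j (i - 1))
            & (va_pair X (va_d X (a j i)) f = va_pi X f (a j i) /\
               va_pi X f (a j i) = (i + 1)%:~R *: a j (i + 1)) /\
              (va_pair X (va_d X (a j i)) h = va_pi X h (a j i) /\
               va_pi X h (a j i) = (1 - 2 * i)%:~R *: a j i)]].
Proof.
have [S_span k_neq0'] : <<[:: e; f; h]>>%VS = S /\ k != 0.
  by split; [exact: span_basis | apply/eqP].
have Xs := levi_split B_semisimple ker_d S_levi S_basis ef he hf e1f.
have cap1N : (<[1]> :&: \sum_j N j = 0)%VS.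
  by move: A_direct; rewrite directv_addE => /and3P[_ _ /eqP].
have capN1 j : (N j :&: <[1]> = 0)%VS.
  by apply/eqP; rewrite -subv0 -cap1N capvC capvS // (sumv_sup j).
have N_doublet j := irreducible_doublet Xs k_neq0' S_span (N_irr j) (capN1 j).
have k1 : k = 1.
  (* Any summand yields k = 1; without summands A = C.1 would be a trivial module. *)
  have [j _ | l0] := pickP 'I_l; first by have [] := N_doublet j.
  case: A_nontrivial => u a.
  have : a \in (<[1]> + \sum_j N j)%VS by rewrite A_sum memvf.
  rewrite big_pred0 // addv0 => /vlineP[c ->].
  by rewrite va_piZ va_pi1 scaler0.
subst k.
have dimN j : \dim (N j) = 2%N.
  by have [_ [v [_ _ /size_basis <-]]] := N_doublet j.
have dimA : \dim (fullv : {vspace A}) = (2 * l).+1.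
  rewrite -A_sum (directvP A_direct) /= dim_vline oner_neq0 add1n; congr _.+1.
  rewrite (eq_bigr (fun=> 2%N)); last by move=> j _; exact: dimN.
  by rewrite sum_nat_const card_ord mulnC.
have ker_eq : lker (va_d X) = <[1]>%VS.
  apply/eqP; rewrite eqEsubv; apply/andP; split; apply/subvP => a.
    move=> /ker_d a_inv; have [//|//|c ->] := invariant_scalar Xs k_neq0' (a := a).
    by apply/vlineP; exists c.
  by move=> /vlineP[c ->]; apply/ker_d => u; rewrite va_piZ va_pi1 scaler0.
have dimLeib : \dim (Leib (va_br X) fullv) = (2 * l)%N.
  (* Rank-nullity: dim A = 2 l + 1 and the kernel of d is a line. *)
  have := limg_ker_dim (va_d X) fullv.
  rewrite -Leib_limg // capfv ker_eq dim_vline oner_neq0 dimA add1n.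
  by case.
have N_mul x y j j' : x \in N j -> y \in N j' -> x * y = 0.
  have [_ [v [_ dv Nv]]] := N_doublet j.
  have [_ [w [_ dw Nw]]] := N_doublet j'.
  rewrite -(span_basis Nv) -(span_basis Nw).
  have vw := mul_doublet Xs dv dw.
  move=> /span2P[x1 [x2 ->]] /span2P[y1 [y2 ->]].
  rewrite mulrDl !mulrDr -!scalerAl -!scalerAr.
  by rewrite !vw ?inE ?eqxx ?orbT // !scaler0 !addr0.
split.
  split=> //; last by rewrite (sl2_pair_hh Xs) mulr1.
  by split; [exact: sl2_pair_ee Xs | exact: sl2_pair_ff Xs
            | exact: sl2_pair_eh Xs | exact: sl2_pair_fh Xs].
split; first exact: ker_eq.
split; first by split.
split.
  apply: (local_square_zero A_sum) => _ _ /memv_sumP[x xN ->] /memv_sumP[y yN ->].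
  rewrite mulr_suml big1 // => j _; rewrite mulr_sumr big1 // => j' _.
  by apply: (N_mul _ _ j j'); [exact: xN | exact: yN].
move=> a0 a0_hw a.
have dblt j : doublet X e f h (a j 0) (a j 1) /\ basis_of (N j) [:: a j 0; a j 1].
  have [_ [v [_ dv Nv]]] := N_doublet j.
  exact: highest_weight_doublet dv Nv (a0_hw j).
pose s := [seq a j i | j <- enum 'I_l, i <- [:: 0; 1 : int]].
have size_s : size s = (2 * l)%N.
  by rewrite size_allpairs size_enum_ord mulnC.
have s_mem j i : i \in [:: 0; 1 : int] -> a j i \in s.
  by move=> i01; apply: allpairs_f; rewrite ?mem_enum.
have full_s : (fullv <= <<1%R :: s>>)%VS.
  rewrite -A_sum subv_add -memvE memv_span ?mem_head //=.
  apply/subv_sumP => j _; have [_ /span_basis <-] := dblt j.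
  by apply: sub_span => u; rewrite !inE => /orP[] /eqP->; rewrite s_mem ?orbT.
have s_d : [seq va_d X (a j i) | j <- enum 'I_l, i <- [:: 0; 1 : int]]
           = map (va_d X) s by rewrite map_allpairs.
split.
- by rewrite basisEdim full_s /= size_s dimA.
- rewrite s_d basisEdim dimLeib size_map size_s leqnn andbT Leib_limg //.
  (* As d 1 = 0, the images of the other vectors span d A; counting dimensions makes them a
     basis. *)
  apply: subv_trans (limgS _ full_s) _; rewrite limg_span.
  apply/span_subvP => u /=; rewrite inE => /orP[/eqP->|/memv_span//].
  have : (1 : A) \in lker (va_d X) by rewrite ker_eq memv_line.
  by rewrite memv_ker => /eqP->; rewrite mem0v.
move=> j j' i i' i01 i'01.
have [dj /span_basis Nj] := dblt j; have [dj' /span_basis Nj'] := dblt j'.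
have aN j1 i1 : i1 \in [:: 0; 1 : int] -> a j1 i1 \in N j1.
  have [_ /span_basis <-] := dblt j1 => i1_in; apply: memv_span.
  by move: i1_in; rewrite !inE => /orP[] /eqP->; rewrite eqxx ?orbT.
have [d0e d1e d0h] := dot_doublet_e Xs dj.
have [d1f d0f d1h] := dot_doublet_f Xs dj.
have [e0 e1 f0 f1 h0 h1] := dj.
split=> //.
- exact: N_mul (aN _ _ i01) (aN _ _ i'01).
- apply: (dot_d_doublet Xs dj').
  + by apply: N_mul (aN _ _ i01) (aN _ _ _).
  + by apply: N_mul (aN _ _ i01) (aN _ _ _).
  + by move: i'01; rewrite !inE => /orP[] /eqP->; rewrite eqxx ?orbT.
- split; first by rewrite va_pair_d_l.
  (* At i = 0 the coefficient 2 meets the default value a_(-1) = 0; likewise for f at i = 1, where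
     a_2 = 0. *)
  by move: i01; rewrite !inE => /orP[] /eqP->; rewrite ?e0 ?e1 ?scaler0 ?scale1r.
split; (split; first by rewrite va_pair_d_l).
  by move: i01; rewrite !inE => /orP[] /eqP->; rewrite ?f0 ?f1 ?scaler0 ?scale1r.
by move: i01; rewrite !inE => /orP[] /eqP->; rewrite ?h0 ?h1 ?scale1r ?scaleN1r.
Qed.
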